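(* Let $\{\mu_n\}_{n=0}^\infty$ be a sequence of real numbers such that, for some $\epsilon>0$ and some $p\geqslant 2+\epsilon$, there is a constant $M>0$ with $$(n+1)^{p-1}\sum_{i=0}^n\left|\binom{n}{i}(-1)^{n-i}\Delta^{n-i}\mu_i\right|^p<M\qquad (n=0,1,2,\ldots),$$ and let $u\in L^p[0,1]$ be the function with $\mu_n=\int_0^1t^nu(t)\,dt$ for all $n\ge0$, extended by $u(t)=0$ for $t>1$. Then $u$ can be represented by the expansion $$u(t)=\sum_{n=0}^\infty u_n\Phi_n(t),\qquad u_n=\sqrt{2}\sum_{k=0}^\infty\frac{(-1)^k}{k!}\,\mu_k\,P_n\!\left[-i\left(k+\tfrac12\right)\right],$$ where $$\Phi_n(t)=i^n\sqrt{2}\,e^{-t}L_n(2t),$$ and the expansion converges in the norm of $L^2[0,+\infty)$.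
   Context: $i$ in $i^n$ and in the argument of $P_n$ is the imaginary unit (in the displayed condition, $i$ is a summation index). $\Delta$ is the forward difference operator $\Delta\mu_n=\mu_{n+1}-\mu_n$, and $\Delta^k\mu_n=\sum_{m=0}^k(-1)^m\binom{k}{m}\mu_{n+k-m}$, with $\Delta^0$ the identity. $P_n=P_n^{(1/2)}$ are the Pollaczek polynomials with parameter $1/2$, defined by $P_{-1}(y)=0$, $P_0(y)=1$, $(n+1)P_{n+1}(y)-2yP_n(y)+nP_{n-1}(y)=0$ (equivalently $P_n(y)=i^n\,{}_2F_1(-n,\tfrac12+iy;1;2)$); they are evaluated at complex arguments as polynomials. $L_n$ are the classical Laguerre polynomials, $L_n(t)=\sum_{j=0}^n\binom{n}{j}\frac{(-t)^j}{j!}$. Known background: for $p>1$, the displayed condition is equivalent to the existence of $u\in L^p[0,1]$ such that $\mu_n=\int_0^1 t^n u(t)\,dt$ for all $n\ge 0$ (Widder, The Laplace Transform); such $u$ is unique up to a.e. equality. *)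

(* Defs.v *)
From HB Require Import structures.
From mathcomp Require Export all_boot all_order all_algebra.
From mathcomp Require Export complex.
From mathcomp Require Export all_classical all_reals all_analysis.
From mathcomp Require Import ring.

Set Implicit Arguments.
Unset Strict Implicit.
Unset Printing Implicit Defensive.

Import Order.TTheory GRing.Theory Num.Theory.
Import numFieldNormedType.Exports.

Local Open Scope classical_set_scope.
Local Open Scope complex_scope.
Local Open Scope ring_scope.

Section Sequences.
Context {R : pzRingType}.
Implicit Types m : nat -> R.

Definition fdelta m : nat -> R := fun n => m n.+1 - m n.

Definition fdiff (k : nat) m : nat -> R := iter k fdelta m.

Lemma fdiffE k m n :
  fdiff k m n = \sum_(j < k.+1) (-1) ^+ j * 'C(k, j)%:R * m (n + k - j)%N.
Proof.
elim: k n => [|k IH] n.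
  by rewrite big_ord_recl big_ord0 /= expr0 !mul1r addr0 addn0 subn0.
rewrite /fdiff iterS -/(fdiff k m) /fdelta !IH.
rewrite [RHS]big_ord_recl [X in X - _]big_ord_recl.
rewrite !expr0 !bin0 !mul1r !subn0 addSnnS -addrA; congr (_ + _).
rewrite -sumrN.
under [RHS]eq_bigr => i _ do rewrite lift0 binS natrD mulrDr mulrDl.
rewrite big_split /=; congr (_ + _).
  rewrite [RHS]big_ord_recr /= bin_small // mulr0 mul0r addr0.
  exact: eq_bigr.
apply: eq_bigr => i _.
by rewrite exprS mulN1r !mulNr addnS subSS.
Qed.

End Sequences.

Section Polynomials.
Context {R : realType}.

(* [pollaczek_rec n] is the pair (P_n, P_(n-1)), with P_(-1) = 0. *)
Fixpoint pollaczek_rec (n : nat) : {poly R[i]} * {poly R[i]} :=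
  if n is n'.+1 then
    let: (p, q) := pollaczek_rec n' in
    (n'.+1%:R^-1 *: (2 *: ('X * p) - n'%:R *: q), p)
  else (1, 0).

Definition pollaczek (n : nat) : {poly R[i]} := (pollaczek_rec n).1.

Lemma pollaczek0 : pollaczek 0 = 1. Proof. by []. Qed.

(* For n = 0 the coefficient of P_(n-1) vanishes, so P_(-1) plays no role. *)
Lemma pollaczekS n (y : R[i]) :
  n.+1%:R * (pollaczek n.+1).[y] - 2 * y * (pollaczek n).[y]
    + n%:R * (pollaczek n.-1).[y] = 0.
Proof.
have e : (pollaczek_rec n).2 = if n is n'.+1 then pollaczek n' else 0.
  by case: n => // n; rewrite /pollaczek /=; case: pollaczek_rec.
have -> : pollaczek n.+1 = n.+1%:R^-1 *:
    (2 *: ('X * pollaczek n) - n%:R *: (pollaczek_rec n).2).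
  by rewrite /pollaczek /=; case: pollaczek_rec.
rewrite e hornerZ mulrA divff ?pnatr_eq0// mul1r.
rewrite hornerD hornerN !hornerZ hornerM hornerX.
by case: n {e} => [|n] /=; rewrite ?mul0r; ring.
Qed.

Definition laguerre (n : nat) : {poly R} :=
  \poly_(j < n.+1) ('C(n, j)%:R * (-1) ^+ j / j`!%:R).

End Polynomials.

Section LpSpaces.
Context {R : realType}.
Implicit Types D : set R.

(* L^p(D) for Lebesgue measure, through extension by zero outside D. *)
Definition in_Lp D (p : R) (f : R -> R) : Prop :=
  (f \_ D : measurableTypeR R -> R) \in Lfun (@lebesgue_measure R) p%:E.

Definition in_Lp_complex D (p : R) (f : R -> R[i]) : Prop :=
  in_Lp D p (fun t => complex.Re (f t)) /\ in_Lp D p (fun t => complex.Im (f t)).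

Definition Lp_norm D (p : R) (f : R -> R[i]) : \bar R :=
  Lnorm (@lebesgue_measure R) p%:E
    (EFin \o ((fun t => ComplexField.Normc.normc (f t)) \_ D)).

(* The series of the f_n converges to s in the norm of L^p(D). *)
Definition Lp_series_cvg D (p : R) (f : nat -> R -> R[i]) (s : R -> R[i]) : Prop :=
  [/\ forall n, in_Lp_complex D p (f n),
      in_Lp_complex D p s &
      Lp_norm D p (fun t => s t - \sum_(n < N) f n t) @[N --> \oo] --> 0%E].

End LpSpaces.

Section Expansion.
Context {R : realType}.

Definition Phi (n : nat) (t : R) : R[i] :=
  'i%C ^+ n * (Num.sqrt 2 * expR (- t) * (laguerre n).[2 * t])%:C.

(* [R[i]^o] carries the topology of the modulus. *)
Definition coef_series (mu : nat -> R) (n : nat) : nat -> R[i]^o :=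
  series (fun k => ((-1) ^+ k / k`!%:R * mu k)%:C
                   * (pollaczek n).[- 'i%C * (k%:R + 2^-1)] : R[i]^o).

Definition coef (mu : nat -> R) (n : nat) : R[i] :=
  (Num.sqrt 2)%:C * limn (coef_series mu n).

End Expansion.

(* Main.v *)
Require Import Defs.
From mathcomp Require Import measurable_realfun ring lra.

Set Implicit Arguments.
Unset Strict Implicit.
Unset Printing Implicit Defensive.

Import Order.TTheory GRing.Theory Num.Theory.
Import numFieldNormedType.Exports.
Local Open Scope classical_set_scope.
Local Open Scope complex_scope.
Local Open Scope ring_scope.

(** The proof identifies the given coefficients with Laguerre coefficients of
    [u] and then shows that the Laguerre expansion of [u] converges.

    Coefficients. At the points [- i (k + 1/2)] the Pollaczek polynomials take
    the values [(- i)^n D(n, k)], where [D(n, k) = sum_j C(n, j) C(k, j) 2^j] are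
    the Delannoy numbers, because both sides obey the same three-term recurrence
    in [n] (lemmas [delannoy_rec] and [pollaczek_delannoy]).  On the other hand
    [(-1)^k D(n, k) / k!] is the [k]-th Taylor coefficient of
    [exp (- t) L_n(2 t)].  Integrating this Taylor expansion term by term
    against [u] on [[0, 1]] turns the series of the statement into
    [(- i)^n] times the integral of [exp (- t) L_n(2 t) u(t)]
    ([delannoy_moment_cvg]).  Since [(- i)^n i^n = 1], the [n]-th term of the
    expansion is the [n]-th term of the ordinary real Fourier expansion of [u]
    along the functions [g_n(t) = sqrt 2 exp (- t) L_n(2 t)] ([coef_PhiE]).

    Completeness. The [g_n] are orthonormal in the space
    [L^2] of the half-line ([laguerre_fun_orthonormal]), hence the functions whose expansion converges
    to them form a closed linear subspace ([expandable_closed]).  This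
    subspace contains every exponential [exp (- a t)], [a > 0], because Parseval's
    identity reduces for it to a geometric series ([exp_expandable]).  By the
    Weierstrass theorem in the variable [s = exp (- t)] it contains the
    continuous functions with bounded support ([continuous_expandable]); by
    density of continuous functions in [L^1] it contains bounded functions
    supported in [[0, 1]], and by truncation all square integrable ones
    ([L2_expandable]).

    Finally [u] is square integrable because [p >= 2] and its support lies in
    [[0, 1]]. *)

(** * Orthonormal expansions in L^2 *)

Lemma nneg_cvg0P (R : realType) (a : nat -> R) : (forall n, 0 <= a n) ->
  a @ \oo --> (0 : R) <-> forall eps, 0 < eps -> \forall n \near \oo, a n < eps.
Proof.
move=> a0; split=> [/cvgr0Pnorm_lt acv eps eps0|acv].
  by apply: filterS (acv _ eps0) => n; rewrite ger0_norm.
by apply/cvgr0Pnorm_lt => eps eps0; apply: filterS (acv _ eps0) => n;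
  rewrite ger0_norm.
Qed.

Lemma cvg0_double (R : realType) (a b : nat -> R) :
  a @ \oo --> (0 : R) -> b @ \oo --> (0 : R) ->
  (fun n => 2 * a n + 2 * b n) @ \oo --> (0 : R).
Proof.
move=> a0 b0; rewrite -[X in _ --> X](_ : 2 * 0 + 2 * 0 = 0 :> R); last by ring.
by apply: cvgD; [exact: (cvgMl_tmp a0)|exact: (cvgMl_tmp b0)].
Qed.

Section L2.
Context d (T : measurableType d) (R : realType).
Variable mu : {measure set T -> \bar R}.
Implicit Types f g h : T -> R.
Local Notation L2 := (Lfun mu 2%:E).

(** The inner product is locked: unification would otherwise unfold it down to
    the Lebesgue integral whenever two such expressions are compared. *)
Definition ip f g : R := locked (\int[mu]_t (f t * g t)).

Lemma ipE f g : ip f g = \int[mu]_t (f t * g t).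
Proof. by rewrite /ip -lock. Qed.

Lemma Lfun2_measurable f : f \in L2 -> measurable_fun setT f.
Proof. by rewrite inE => /andP[/[!inE]]. Qed.

Lemma Lfun2_sqr_integrable f : measurable_fun setT f ->
  mu.-integrable setT (EFin \o (fun t => f t ^+ 2)) -> f \in L2.
Proof.
move=> mf /integrableP[_ If]; rewrite inE; apply/andP; split; rewrite inE//=.
rewrite /finite_norm unlock poweR_lty//.
apply: le_lt_trans If; rewrite le_eqVlt; apply/orP; left; apply/eqP.
by apply: eq_integral => t _; rewrite /= normrX powR_mulrn.
Qed.

Lemma ip_integrable f g : f \in L2 -> g \in L2 ->
  mu.-integrable setT (EFin \o (fun t => f t * g t)).
Proof. by move=> fL gL; apply/Lfun1_integrable; exact: Lfun2_mul_Lfun1. Qed.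

Lemma ipC f g : ip f g = ip g f.
Proof. by rewrite !ipE; apply: eq_Rintegral => t _; rewrite mulrC. Qed.

Lemma ipDl f g h : f \in L2 -> g \in L2 -> h \in L2 ->
  ip (f + g) h = ip f h + ip g h.
Proof.
move=> fL gL hL; rewrite !ipE -RintegralD ?ip_integrable//.
by apply: eq_Rintegral => t _; rewrite -mulrDl.
Qed.

Lemma ipZl a f h : f \in L2 -> h \in L2 -> ip (a *: f) h = a * ip f h.
Proof.
move=> fL hL; rewrite !ipE -RintegralZl ?ip_integrable//.
by apply: eq_Rintegral => t _; rewrite mulrA.
Qed.

Lemma ip_ge0 f : 0 <= ip f f.
Proof. by rewrite ipE; apply: Rintegral_ge0 => t _; rewrite -expr2 sqr_ge0. Qed.

Lemma L2D f g : f \in L2 -> g \in L2 -> f + g \in L2.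
Proof. by move=> fL gL; rewrite rpredD ?lee1n. Qed.

Lemma L2Z a f : f \in L2 -> a *: f \in L2.
Proof. by move=> fL; rewrite rpredZ ?lee1n. Qed.

Lemma L2B f g : f \in L2 -> g \in L2 -> f - g \in L2.
Proof. by move=> fL gL; rewrite rpredB ?lee1n. Qed.

Lemma L20 : 0 \in L2.
Proof. by rewrite rpred0 ?lee1n. Qed.

Lemma L2_sum (I : Type) (s : seq I) (F : I -> T -> R) :
  (forall i, F i \in L2) -> \sum_(i <- s) F i \in L2.
Proof. by move=> FL; rewrite rpred_sum ?lee1n. Qed.

Lemma ip0l h : h \in L2 -> ip 0 h = 0.
Proof. by move=> hL; rewrite -(scale0r 0) ipZl ?L20// mul0r. Qed.

Lemma ipBl f g h : f \in L2 -> g \in L2 -> h \in L2 ->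
  ip (f - g) h = ip f h - ip g h.
Proof. by move=> fL gL hL; rewrite -scaleN1r ipDl ?L2Z// ipZl// mulN1r. Qed.

Lemma ip_suml (I : Type) (s : seq I) (F : I -> T -> R) h :
  (forall i, F i \in L2) -> h \in L2 ->
  ip (\sum_(i <- s) F i) h = \sum_(i <- s) ip (F i) h.
Proof.
move=> FL hL; elim: s => [|i s IH]; first by rewrite !big_nil ip0l.
by rewrite !big_cons ipDl ?L2_sum// IH.
Qed.

Lemma ip_sqrB f g : f \in L2 -> g \in L2 ->
  ip (f - g) (f - g) = ip f f - 2 * ip f g + ip g g.
Proof.
move=> fL gL; rewrite ipBl ?L2B// ![ip _ (f - g)]ipC !ipBl// (ipC g f).
by ring.
Qed.

(** Weak triangle inequality, from [ip (f - g) (f - g) >= 0]; it replaces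
    Minkowski's inequality in the closure arguments below. *)
Lemma ip_sqrD_le f g : f \in L2 -> g \in L2 ->
  ip (f + g) (f + g) <= 2 * ip f f + 2 * ip g g.
Proof.
move=> fL gL; have := ip_ge0 (f - g).
rewrite ip_sqrB// ipDl ?L2D// ![ip _ (f + g)]ipC !ipDl// (ipC g f).
by move: (ip f f) (ip f g) (ip g g) => a b c; lra.
Qed.

Section Orthonormal.
Variable e : nat -> T -> R.
Hypothesis eL : forall n, e n \in L2.
Hypothesis e_on : forall m n, ip (e m) (e n) = (m == n)%:R.

Definition partial_exp N f : T -> R := \sum_(n < N) ip f (e n) *: e n.

Lemma partial_exp_L2 N f : partial_exp N f \in L2.
Proof. by apply: L2_sum => i; exact: L2Z. Qed.

(** The residual is orthogonal to the span of the [e n]; this yields at once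
    Bessel's inequality and Parseval's criterion for [expandable]. *)
Lemma residual_sqr N f : f \in L2 ->
  ip (f - partial_exp N f) (f - partial_exp N f) =
  ip f f - \sum_(n < N) ip f (e n) ^+ 2.
Proof.
move=> fL; rewrite ip_sqrB ?partial_exp_L2//.
have -> : ip f (partial_exp N f) = \sum_(n < N) ip f (e n) ^+ 2.
  rewrite ipC /partial_exp ip_suml//; last by move=> i; exact: L2Z.
  by apply: eq_bigr => i _; rewrite ipZl// ipC expr2.
have -> : ip (partial_exp N f) (partial_exp N f) =
    \sum_(n < N) ip f (e n) ^+ 2; last by ring.
rewrite {1}/partial_exp ip_suml ?partial_exp_L2//; last by move=> i; exact: L2Z.
apply: eq_bigr => i _; rewrite ipZl ?partial_exp_L2// [ip (e i) _]ipC.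
rewrite {1}/partial_exp ip_suml//; last by move=> j; exact: L2Z.
rewrite (bigD1 i)//= ipZl// e_on eqxx mulr1 big1 ?addr0 ?expr2// => j ji.
by rewrite ipZl// e_on (_ : (_ == _) = false) ?mulr0//; apply/negbTE.
Qed.

(** Convergence is stated for the squared norm of the residual, which avoids
    square roots. *)
Definition expandable f :=
  f \in L2 /\
  (fun N => ip (f - partial_exp N f) (f - partial_exp N f)) @ \oo --> (0 : R).

Lemma residual_le N f : f \in L2 ->
  ip (f - partial_exp N f) (f - partial_exp N f) <= ip f f.
Proof.
by move=> fL; rewrite residual_sqr// gerBl sumr_ge0// => i _; exact: sqr_ge0.
Qed.

Lemma partial_expB N f g : f \in L2 -> g \in L2 ->
  partial_exp N (f - g) = partial_exp N f - partial_exp N g.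
Proof.
move=> fL gL; rewrite /partial_exp -sumrB.
by apply: eq_bigr => i _; rewrite ipBl// scalerBl.
Qed.

Lemma partial_expD N f g : f \in L2 -> g \in L2 ->
  partial_exp N (f + g) = partial_exp N f + partial_exp N g.
Proof.
move=> fL gL; rewrite /partial_exp -big_split.
by apply: eq_bigr => i _; rewrite ipDl// scalerDl.
Qed.

Lemma partial_expZ N a f : f \in L2 ->
  partial_exp N (a *: f) = a *: partial_exp N f.
Proof.
move=> fL; rewrite /partial_exp scaler_sumr.
by apply: eq_bigr => i _; rewrite ipZl// scalerA.
Qed.

(** Taking residuals is linear and, by Bessel, a contraction: the residual of
    [f] is controlled by [f - g] plus the residual of [g]. *)
Lemma expandable_closed f : f \in L2 ->
  (forall eps, 0 < eps -> exists2 g, expandable g & ip (f - g) (f - g) < eps) ->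
  expandable f.
Proof.
move=> fL fapp; split=> //; apply/nneg_cvg0P => [N|eps eps0]; first exact: ip_ge0.
have eps4 : 0 < eps / 4 by lra.
have [g [gL /nneg_cvg0P gcv] gf] := fapp _ eps4.
apply: filterS (gcv _ _ eps4) => [N gN|N]; last exact: ip_ge0.
have -> : f - partial_exp N f =
    (f - g - partial_exp N (f - g)) + (g - partial_exp N g).
  rewrite partial_expB//; apply/funext => t; rewrite !fctE/=; ring.
apply: le_lt_trans (ip_sqrD_le _ _) _; rewrite ?L2B ?partial_exp_L2 ?L2B//.
have := residual_le N (L2B fL gL); move: gN gf.
move: (ip (_ - _ - _) _) (ip (g - _) _) (ip (f - g) _) => a b c; lra.
Qed.

Lemma expandableD f g : expandable f -> expandable g -> expandable (f + g).
Proof.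
move=> [fL fc] [gL gc]; split; first exact: L2D.
apply: squeeze_cvgr (cvg0_double fc gc); last exact: cvg_cst.
apply: nearW => N; rewrite ip_ge0/=.
have -> : f + g - partial_exp N (f + g) =
    (f - partial_exp N f) + (g - partial_exp N g).
  by rewrite partial_expD// opprD addrACA.
by apply: ip_sqrD_le; rewrite ?L2B ?partial_exp_L2.
Qed.

Lemma expandableZ a f : expandable f -> expandable (a *: f).
Proof.
move=> [fL fc]; split; first exact: L2Z.
have -> : (fun N => ip (a *: f - partial_exp N (a *: f))
      (a *: f - partial_exp N (a *: f))) =
    (fun N => a ^+ 2 * ip (f - partial_exp N f) (f - partial_exp N f)).
  apply/funext => N; rewrite partial_expZ// -scalerBr.
  by rewrite ipZl ?L2Z ?L2B ?partial_exp_L2// ipC ipZl ?L2B ?partial_exp_L2// mulrA.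
rewrite -[X in _ --> X](mulr0 (a ^+ 2)).
exact: (cvgMl_tmp fc).
Qed.

Lemma expandable0 : expandable 0.
Proof.
split; first exact: L20.
rewrite (_ : (fun N => _) = fun=> 0); first exact: cvg_cst.
apply/funext => N; rewrite residual_sqr ?L20// ip0l ?L20// big1 ?subr0// => i _.
by rewrite ip0l// expr0n.
Qed.

Lemma expandable_sum (I : Type) (s : seq I) (F : I -> T -> R) :
  (forall i, expandable (F i)) -> expandable (\sum_(i <- s) F i).
Proof.
move=> FE; elim: s => [|i s IH]; first by rewrite big_nil; exact: expandable0.
rewrite big_cons; exact: expandableD (FE i) IH.
Qed.

End Orthonormal.
End L2.

(** * Exponential moments on the half-line *)

Section Moments.
Context {R : realType}.
Local Notation mu := (@lebesgue_measure R).
Local Notation "'R+'" := (`[0, +oo[%classic : set R).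
Implicit Types (a b t : R) (q : {poly R}).

(** [exp (a x)] dominates [(a x)^(n+1) / (n+1)!], hence the expression is at
    most [C / x]. *)
Lemma cvg_exprn_expRN (a : R) n : 0 < a ->
  x ^+ n * expR (- (a * x)) @[x --> +oo] --> (0 : R).
Proof.
move=> a0; apply/cvgr0Pnorm_lt => e e0.
pose C : R := n.+1`!%:R / a ^+ n.+1.
near=> x.
have x0 : 0 < x by near: x; exact: nbhs_pinfty_gt.
have Cx : C / e < x by near: x; apply: nbhs_pinfty_gt; exact: num_real.
rewrite ger0_norm ?mulr_ge0 ?exprn_ge0 ?expR_ge0 ?ltW//.
rewrite expRN ltr_pdivrMr ?expR_gt0//.
have := expR_ge1Dxn n (mulr_ge0 (ltW a0) (ltW x0)).
move=> /(lt_le_trans _) h.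
have {}h : (a * x) ^+ n.+1 / n.+1`!%:R < expR (a * x) by apply: h; rewrite ltrDr.
have f0 : 0 < n.+1`!%:R :> R by rewrite ltr0n fact_gt0.
have -> : x ^+ n = C / x * ((a * x) ^+ n.+1 / n.+1`!%:R).
  rewrite /C exprMn !exprS; field.
  by rewrite !gt_eqF//= exprn_gt0.
apply: ltr_pM => //.
- by rewrite !divr_ge0 ?exprn_ge0 ?ltW.
- by rewrite !(divr_ge0, exprn_ge0, mulr_ge0) ?ltW.
- by rewrite ltr_pdivrMr// mulrC -ltr_pdivrMr.
Unshelve. all: by end_near. Qed.

(** The tail integral of [s^n exp (- a s)] over [[t, +oo[], given by the
    recursion that integration by parts produces; its value at [0] is the
    moment to be computed. *)
Fixpoint exp_prim a n t : R :=
  if n is n'.+1 then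
    (t ^+ n * expR (- (a * t)) + n%:R * exp_prim a n' t) / a
  else expR (- (a * t)) / a.

Lemma is_derive_exp_prim a n t : a != 0 ->
  is_derive t 1 (exp_prim a n) (- (t ^+ n * expR (- (a * t)))).
Proof.
move=> a0; have dexp (x : R) : is_derive x 1 (fun t => expR (- (a * t)))
    (- a * expR (- (a * x))).
  have -> : (fun t => expR (- (a * t))) = expR \o (- a *: (id : R -> R)).
    by apply/funext => s; rewrite !fctE /GRing.scale/= mulNr.
  by apply: is_derive_eq; rewrite /= ?fctE /GRing.scale/= mulr1 mulNr mulrC.
elim: n t => [|n IH] t /=.
  rewrite (_ : (fun t => _) = (a^-1 *: (fun t => expR (- (a * t))))); last first.
    by apply/funext => s; rewrite fctE mulrC.
  by apply: is_derive_eq; rewrite expr0 mul1r; rewrite /GRing.scale/=; field.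
rewrite (_ : (fun t => _) = (a^-1 *: ((id ^+ n.+1) * (fun t => expR (- (a * t)))
   + n.+1%:R *: exp_prim a n))); last first.
  by apply/funext => s; rewrite !fctE mulrC.
have dM := is_deriveM (is_deriveX n.+1 (is_derive_id t (1 : R))) (dexp t).
have dS := is_deriveZ a^-1 (is_deriveD dM (is_deriveZ n.+1%:R (IH t))).
apply: (@is_derive_eq _ _ _ _ _ _ _ _ dS).
rewrite /GRing.scale/= !fctE exprS. by field.
Qed.

Lemma exp_prim0 a n : exp_prim a n 0 = n`!%:R / a ^+ n.+1.
Proof.
elim: n => [|n IH] /=; first by rewrite mulr0 oppr0 expR0 fact0 expr1.
rewrite expr0n mul0r add0r IH factS natrM [in RHS]exprS invfM; ring.
Qed.

Lemma cvg_exp_prim a n : 0 < a -> exp_prim a n x @[x --> +oo] --> (0 : R).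
Proof.
move=> a0; elim: n => [|n IH] /=.
  rewrite -(mul0r a^-1); apply: cvgMr_tmp.
  have := cvg_exprn_expRN 0 a0.
  by under eq_fun do rewrite expr0 mul1r.
rewrite -(mul0r a^-1); apply: cvgMr_tmp.
rewrite -(addr0 (0 : R)) -[X in _ + X](mulr0 n.+1%:R).
by apply: cvgD; [exact: cvg_exprn_expRN|exact: cvgMl_tmp].
Qed.

Lemma continuous_horner_expR a b q :
  continuous (fun t => q.[b * t] * expR (- (a * t)) : R).
Proof.
move=> t; apply: cvgM; last first.
  apply: continuous_comp; last exact: continuous_expR.
  by apply: cvgN; apply: cvgMl_tmp; exact: cvg_id.
apply: (@continuous_comp _ _ _ ( *%R b) (horner q)); last exact: continuous_horner.
by apply: cvgMl_tmp; exact: cvg_id.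
Qed.

Lemma integral_exprn_expRN a n : 0 < a ->
  (\int[mu]_(t in R+) (t ^+ n * expR (- (a * t)))%:E = (n`!%:R / a ^+ n.+1)%:E)%E.
Proof.
move=> a0; have an0 := lt0r_neq0 a0.
have dP t : is_derive t 1 (- exp_prim a n) (t ^+ n * expR (- (a * t))).
  have ? := is_derive_exp_prim n t an0.
  by apply: is_derive_eq; rewrite opprK.
rewrite (@ge0_continuous_FTC2y _ _ (- exp_prim a n) _ 0).
- by rewrite fctE exp_prim0 -EFinD opprK add0r.
- by move=> x x0; rewrite mulr_ge0 ?exprn_ge0 ?expR_ge0.
- apply: continuous_subspaceT => t.
  have := @continuous_horner_expR a 1 'X^n t.
  by under eq_fun do rewrite hornerXn mul1r.
- by rewrite -oppr0; apply: cvgN; exact: cvg_exp_prim.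
- by move=> x _; exact: ex_derive.
- apply: cvg_at_right_filter; apply: differentiable_continuous.
  by apply/derivable1_diffP; exact: ex_derive.
- by move=> x _; rewrite derive1E derive_val.
Qed.

Lemma integrable_exprn_expRN a n : 0 < a ->
  mu.-integrable R+ (EFin \o (fun t => t ^+ n * expR (- (a * t)))).
Proof.
move=> a0; apply/integrableP; split.
  apply/measurable_EFinP; apply: measurable_funTS.
  apply: continuous_measurable_fun.
  have := @continuous_horner_expR a 1 'X^n.
  by under eq_fun do rewrite hornerXn mul1r.
under eq_integral => t.
  rewrite inE/= in_itv/= andbT => t0.
  rewrite ger0_norm ?mulr_ge0 ?exprn_ge0 ?expR_ge0//.
  over.
by rewrite /= integral_exprn_expRN// ltry.
Qed.

Lemma integrable_horner_expR a b q : 0 < a ->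
  mu.-integrable R+ (EFin \o (fun t => q.[b * t] * expR (- (a * t)))).
Proof.
move=> a0; have -> : EFin \o (fun t => q.[b * t] * expR (- (a * t))) =
  (fun t => \sum_(i < size q)
     ((q`_i * b ^+ i)%:E * (t ^+ i * expR (- (a * t)))%:E))%E.
  apply/funext => t; rewrite /= horner_coef mulr_suml sumEFin/=; congr _%:E.
  by apply: eq_bigr => i _; rewrite exprMn; ring.
apply: integrable_sum => // i _.
by apply: integrableZl => //; exact: integrable_exprn_expRN.
Qed.

Lemma Rintegral_sum d (T : measurableType d) (m : {measure set T -> \bar R})
    (D : set T) (I : Type) (s : seq I) (F : I -> T -> R) :
  measurable D -> (forall i, m.-integrable D (EFin \o F i)) ->
  \int[m]_(t in D) (\sum_(i <- s) F i t) = \sum_(i <- s) \int[m]_(t in D) F i t.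
Proof.
move=> mD iF; elim: s => [|i s IH].
  rewrite big_nil; under eq_Rintegral do rewrite big_nil.
  by rewrite Rintegral_cst// mul0r.
rewrite big_cons -IH -RintegralD//; last first.
  have := integrable_sum mD s (P := predT) (fun i _ => iF i).
  by apply: eq_integrable => // t _; rewrite /= sumEFin.
by apply: eq_Rintegral => t _; rewrite big_cons.
Qed.

Lemma Rintegral_horner_expR a b q N : 0 < a -> (size q <= N)%N ->
  \int[mu]_(t in R+) (q.[b * t] * expR (- (a * t))) =
  \sum_(i < N) q`_i * b ^+ i * i`!%:R / a ^+ i.+1.
Proof.
move=> a0 qN.
transitivity (\int[mu]_(t in R+) \sum_(i < N)
    (q`_i * b ^+ i) * (t ^+ i * expR (- (a * t)))).
  apply: eq_Rintegral => t _; rewrite (horner_coef_wide _ qN) mulr_suml.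
  by apply: eq_bigr => i _; rewrite exprMn; ring.
have ii (i : 'I_N) := integrable_exprn_expRN i a0.
rewrite Rintegral_sum//; last first.
  by move=> i; exact: (integrableZl _ _ (ii i)).
apply: eq_bigr => i _; rewrite RintegralZl//.
by rewrite /Rintegral integral_exprn_expRN//= mulrA.
Qed.

End Moments.

(** * Laguerre functions: orthonormality and expansion of exponentials *)

Lemma big_ord_wide (V : nmodType) N M (F : nat -> V) : (N <= M)%N ->
  (forall j, (N <= j)%N -> F j = 0) -> \sum_(j < M) F j = \sum_(j < N) F j.
Proof.
move=> NM F0; rewrite (big_ord_widen _ F NM) [RHS]big_mkcond.
by apply: eq_bigr => j _; case: ltnP => // /F0.
Qed.

Section BinomialSums.
Context {R : comNzRingType}.

(** Pascal's rule as a recursion on binomially weighted sums; with [x = -1] the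
    right-hand side is a finite difference of [f]. *)
Lemma sum_binS (x : R) n (f : nat -> R) :
  \sum_(j < n.+2) 'C(n.+1, j)%:R * x ^+ j * f j =
  \sum_(j < n.+1) 'C(n, j)%:R * x ^+ j * (f j + x * f j.+1).
Proof.
rewrite big_ord_recl.
under eq_bigr do rewrite lift0 binS natrD 2!mulrDl.
rewrite big_split /= [X in _ + (X + _)]big_ord_recr /=.
rewrite (bin_small (ltnSn n)) !mul0r addr0.
under [in RHS]eq_bigr do rewrite mulrDr.
rewrite big_split/= addrA; congr (_ + _); last first.
  by apply: eq_bigr => j _; rewrite exprSr !mulrA.
by rewrite [in RHS]big_ord_recl/= !bin0.
Qed.

(** The left-hand side is, up to sign, the [n]-th finite difference at [s] of
    the polynomial [C(x, m)] in [x], and each difference lowers [m] by one. *)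
Lemma alt_sum_bin2 n s m :
  \sum_(j < n.+1) 'C(n, j)%:R * (-1) ^+ j * 'C(j + s, m)%:R =
  (-1) ^+ n * (if (n <= m)%N then 'C(s, m - n) else 0)%:R :> R.
Proof.
elim: n s m => [|n IH] s m.
  by rewrite big_ord_recl big_ord0 /= bin0 expr0 !mul1r addr0 add0n subn0.
rewrite (sum_binS (-1) n (fun j => 'C(j + s, m)%:R)).
under eq_bigr do rewrite mulN1r mulrBr addSnnS.
rewrite sumrB !IH; case: ltngtP => [nm|mn|->].
- rewrite -[(m - n)%N]prednK ?subn_gt0// -subnS binS natrD.
  by rewrite exprS; ring.
- by rewrite !mulr0 subrr.
- by rewrite subnn !bin0 subrr mulr0.
Qed.

End BinomialSums.

Section Laguerre.
Context {R : realType}.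
Local Notation mu := (@lebesgue_measure R).
Local Notation "'R+'" := (`[0, +oo[%classic : set R).
Local Notation "''L_' n" := (@laguerre R n) (at level 8, n at level 2).
Implicit Types (a b t : R) (p q : {poly R}).

Lemma laguerreE n :
  'L_n = \sum_(j < n.+1) ('C(n, j)%:R * (-1) ^+ j / j`!%:R) *: 'X^j.
Proof. by rewrite /laguerre poly_def. Qed.

Lemma size_laguerre n : (size 'L_n <= n.+1)%N.
Proof. exact: size_poly. Qed.

(** The integral of [p(x) exp (- x)] over the half-line, as an algebraic
    functional: it replaces ['X^i] by [i!]. *)
Definition fact_eval p : R := \sum_(i < size p) p`_i * i`!%:R.

Lemma fact_eval_wide N p : (size p <= N)%N ->
  fact_eval p = \sum_(i < N) p`_i * i`!%:R.
Proof.
move=> pN; rewrite (big_ord_wide pN (F := fun i => p`_i * i`!%:R))//.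
by move=> i /(nth_default 0) ->; rewrite mul0r.
Qed.

Lemma fact_evalD p q : fact_eval (p + q) = fact_eval p + fact_eval q.
Proof.
rewrite (fact_eval_wide (size_polyD p q)) (fact_eval_wide (leq_maxl _ (size q))).
rewrite (fact_eval_wide (leq_maxr (size p) _)) -big_split.
by apply: eq_bigr => i _; rewrite coefD mulrDl.
Qed.

Lemma fact_evalZ a p : fact_eval (a *: p) = a * fact_eval p.
Proof.
rewrite (fact_eval_wide (size_scale_leq a p)) mulr_sumr.
by apply: eq_bigr => i _; rewrite coefZ mulrA.
Qed.

Lemma fact_eval_sum I (s : seq I) (F : I -> {poly R}) :
  fact_eval (\sum_(i <- s) F i) = \sum_(i <- s) fact_eval (F i).
Proof.
elim: s => [|i s IH]; first by rewrite !big_nil /fact_eval size_poly0 big_ord0.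
by rewrite !big_cons fact_evalD IH.
Qed.

Lemma fact_evalXn n : fact_eval 'X^n = n`!%:R.
Proof.
rewrite (fact_eval_wide (N := n.+1)) ?size_polyXn// big_ord_recr/= coefXn eqxx.
by rewrite mul1r big1 ?add0r// => i _; rewrite coefXn ltn_eqF ?ltn_ord ?mul0r.
Qed.

(** Orthogonality is two applications of [alt_sum_bin2]: the factor [L_m]
    annihilates all powers below [m], and what remains is again an alternating
    sum of products of binomials. *)
Lemma fact_eval_laguerreM m n : fact_eval ('L_m * 'L_n) = (m == n)%:R.
Proof.
have lagXj j : fact_eval ('L_m * 'X^j) = (-1) ^+ m * j`!%:R * 'C(j, m)%:R.
  rewrite laguerreE mulr_suml fact_eval_sum.
  have -> : (-1) ^+ m * j`!%:R * 'C(j, m)%:R =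
      j`!%:R * ((-1) ^+ m * (if (m <= j)%N then 'C(j, j - m) else 0)%:R) :> R.
    case: leqP => [mj|jm]; first by rewrite bin_sub//; ring.
    by rewrite bin_small//; ring.
  rewrite -alt_sum_bin2 mulr_sumr; apply: eq_bigr => i _.
  rewrite -scalerAl -exprD fact_evalZ fact_evalXn.
  have /(congr1 (fun k => k%:R : R)) := bin_fact (leq_addl i j).
  rewrite addnK !natrM => <-; field.
  by rewrite pnatr_eq0 -lt0n fact_gt0.
rewrite [X in _ * X]laguerreE mulr_sumr fact_eval_sum.
transitivity ((-1) ^+ m * ((-1) ^+ n * (if (n <= m)%N then 'C(0, m - n) else 0)%:R)
   : R).
  rewrite -alt_sum_bin2 mulr_sumr; apply: eq_bigr => j _.
  rewrite -scalerAr fact_evalZ lagXj addn0; field.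
  by rewrite pnatr_eq0 -lt0n fact_gt0.
case: ltngtP => [nm|mn|->]; rewrite ?mulr0//.
- by rewrite -[(m - n)%N]prednK ?subn_gt0// bin0n !mulr0.
- by rewrite subnn bin0 mulr1 -exprD -signr_odd oddD addbb.
Qed.

(** One family covers both kinds of functions in play: [a = 1] gives the Laguerre
    functions, whose polynomial has argument [2 t], and [q = 1] the plain
    exponentials. *)
Definition exp_poly a q : R -> R := (fun t => q.[2 * t] * expR (- (a * t))) \_ R+.

Lemma exp_poly_L2 a q : 0 < a -> exp_poly a q \in Lfun mu 2%:E.
Proof.
move=> a0; apply: Lfun2_sqr_integrable.
  apply/measurable_restrict => //; apply: measurable_funTS.
  by apply: continuous_measurable_fun; exact: continuous_horner_expR.
have /integrable_mkcond := integrable_horner_expR 2 (q * q) (addr_gt0 a0 a0).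
move=> /(_ (measurable_itv _)); apply: eq_integrable => // t _.
rewrite /exp_poly /= !patchE; case: ifP => _; last by rewrite expr0n.
by rewrite /= hornerM (mulrDl a) opprD expRD; congr _%:E; ring.
Qed.

Lemma ip_exp_poly a b p q N : 0 < a -> 0 < b -> (size (p * q)%R <= N)%N ->
  ip mu (exp_poly a p) (exp_poly b q) =
  \sum_(i < N) (p * q)`_i * 2 ^+ i * i`!%:R / (a + b) ^+ i.+1.
Proof.
move=> a0 b0 pqN; rewrite -Rintegral_horner_expR ?addr_gt0// Rintegral_mkcond.
rewrite ipE; apply: eq_Rintegral => t _.
rewrite /exp_poly !patchE; case: ifP => _; last by rewrite mul0r.
by rewrite hornerM (mulrDl a) opprD expRD; ring.
Qed.

Definition laguerre_fun n : R -> R := exp_poly 1 (Num.sqrt 2 *: 'L_n).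

Lemma laguerre_fun_L2 n : laguerre_fun n \in Lfun mu 2%:E.
Proof. exact: exp_poly_L2. Qed.

Lemma laguerre_fun_orthonormal m n :
  ip mu (laguerre_fun m) (laguerre_fun n) = (m == n)%:R.
Proof.
have E2 : (Num.sqrt 2 *: 'L_m) * (Num.sqrt 2 *: 'L_n) = (2 : R) *: ('L_m * 'L_n).
  by rewrite -scalerAl -scalerAr scalerA -expr2 sqr_sqrtr.
rewrite (ip_exp_poly (N := size ('L_m * 'L_n)))// E2 ?size_scale_leq//.
rewrite -fact_eval_laguerreM; apply: eq_bigr => i _; rewrite coefZ.
rewrite (_ : 1 + 1 = 2 :> R)// exprS; field.
by rewrite expf_neq0// pnatr_eq0.
Qed.

Lemma ip_exp_laguerre a n : 0 < a ->
  ip mu (exp_poly a 1) (laguerre_fun n) =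
  Num.sqrt 2 / (a + 1) * ((a - 1) / (a + 1)) ^+ n.
Proof.
move=> a0; have a1 : a + 1 != 0 by rewrite gt_eqF// addr_gt0.
rewrite (ip_exp_poly (N := n.+1))//; last first.
  by rewrite mul1r (leq_trans (size_scale_leq _ _)) ?size_laguerre.
have -> : (a - 1) / (a + 1) = 1 + - 2 / (a + 1) by field.
rewrite exprDn mulr_sumr; apply: eq_bigr => i _.
rewrite mul1r coefZ coef_poly ltn_ord expr1n mul1r.
rewrite exprS (exprMn i (- 2)) (exprNn 2) exprVn; field.
by rewrite a1 expf_neq0// pnatr_eq0 -lt0n fact_gt0.
Qed.

Lemma ip_exp a : 0 < a -> ip mu (exp_poly a 1) (exp_poly a 1) = (2 * a)^-1.
Proof.
move=> a0; rewrite (ip_exp_poly (N := 1))// ?mulr1 ?size_poly1//.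
by rewrite big_ord1 coef1/= fact0 expr0 expr1 !mul1r mulr_natl.
Qed.

(** By [ip_exp_laguerre] the squared coefficients form a geometric progression of
    ratio [((a - 1) / (a + 1))^2 < 1] with sum [1 / (2 a)], the squared norm:
    Parseval's identity holds. *)
Lemma exp_expandable a : 0 < a -> expandable mu laguerre_fun (exp_poly a 1).
Proof.
move=> a0; split; first exact: exp_poly_L2.
have a1 : a + 1 != 0 by rewrite gt_eqF// addr_gt0.
pose x := ((a - 1) / (a + 1)) ^+ 2.
rewrite (_ : (fun N => _) = fun N => (2 * a)^-1 * x ^+ N); last first.
  apply/funext => N.
  rewrite (residual_sqr laguerre_fun_L2 laguerre_fun_orthonormal)// ?exp_poly_L2//.
  rewrite ip_exp//; elim: N => [|N IH]; first by rewrite big_ord0 subr0 mulr1.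
  rewrite big_ord_recr /= opprD addrA IH ip_exp_laguerre//.
  have -> : (Num.sqrt 2 / (a + 1) * ((a - 1) / (a + 1)) ^+ N) ^+ 2 =
      2 / (a + 1) ^+ 2 * x ^+ N.
    by rewrite exprMn -exprM mulnC exprM -/x (expr_div_n (Num.sqrt 2)) sqr_sqrtr.
  rewrite (exprS x); move: (x ^+ N) => y.
  by rewrite /x; field; rewrite a1 gt_eqF.
rewrite -[X in _ --> X](mulr0 (2 * a)^-1); apply: cvgMl_tmp.
apply: cvg_expr; rewrite ger0_norm ?sqr_ge0// /x exprMn exprVn.
rewrite ltr_pdivrMr ?exprn_gt0 ?addr_gt0// mul1r -subr_gt0.
by rewrite (_ : _ - _ = 4 * a) ?mulr_gt0//; ring.
Qed.

End Laguerre.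

(** * Bernstein polynomials and the Weierstrass theorem *)

Section Bernstein.
Context {R : realType}.
Implicit Types (f g : nat -> R) (s : R).

(** The expectation of [f] at the number of successes in [N] independent trials of
    probability [s], computed by conditioning on one trial.  In this form
    positivity, linearity and the variance all follow by plain induction,
    without binomial sums. *)
Fixpoint bernstein N f s : R :=
  if N is N'.+1 then
    s * bernstein N' (fun k => f k.+1) s + (1 - s) * bernstein N' f s
  else f 0%N.

Lemma bernstein_poly N f : exists q : {poly R}, forall s, bernstein N f s = q.[s].
Proof.
elim: N f => [|N IH] f; first by exists (f 0%N)%:P => s; rewrite hornerC.
have [q1 q1E] := IH (fun k => f k.+1); have [q2 q2E] := IH f.
exists ('X * q1 + (1 - 'X) * q2) => s.
by rewrite /= !hornerE q1E q2E.
Qed.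

Lemma ler_bernstein N f g s : 0 <= s <= 1 ->
  (forall k, (k <= N)%N -> f k <= g k) -> bernstein N f s <= bernstein N g s.
Proof.
move=> /andP[s0 s1]; elim: N f g => [|N IH] f g fg /=; first exact: fg.
apply: lerD; apply: ler_wpM2l; rewrite ?subr_ge0//; apply: IH => k kN.
  exact: fg.
by apply: fg; exact: leqW.
Qed.

Lemma bernstein_affine N (a b : R) f s :
  bernstein N (fun k => a * f k + b) s = a * bernstein N f s + b.
Proof. by elim: N f => //= N IH f; rewrite !IH; ring. Qed.

(** Bias plus variance of the binomial law.  The centre [x] is arbitrary so that
    the shift of [f] in the recursion can be absorbed in it. *)
Lemma bernstein_sqr N (x s : R) :
  bernstein N (fun k => (k%:R - x) ^+ 2) s =
  (N%:R * s - x) ^+ 2 + N%:R * (s * (1 - s)).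
Proof.
elim: N x => [|N IH] x /=; first by ring.
have -> : (fun k => (k.+1%:R - x) ^+ 2) = (fun k => (k%:R - (x - 1)) ^+ 2).
  by apply/funext => k; rewrite -natr1; ring.
by rewrite !IH -natr1; ring.
Qed.

(** Uniform continuity on [[0, 1]] in the form used with Chebyshev's argument:
    below some distance [d] the values differ by at most [e], and beyond it the
    quadratic term exceeds the oscillation of [F]. *)
Lemma uniform_modulus (F : R -> R) (e : R) : continuous F -> 0 < e ->
  exists2 C, 0 <= C & forall x y, 0 <= x <= 1 -> 0 <= y <= 1 ->
    F x <= F y + e + C * (x - y) ^+ 2.
Proof.
move=> cF e0.
have e2 : 0 < e / 2 by rewrite divr_gt0.
have [d d0 dF] : exists2 d, 0 < d & forall x y, 0 <= x <= 1 ->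
    `|x - y| < d -> F x < F y + e.
  have /compact_near_coveringP := @segment_compact R 0 1.
  move=> /(_ R 0^'+ (fun d x => forall y, `|x - y| < d -> F x < F y + e)).
  case=> [x x01|d /= d0 dP]; last first.
    exists (d / 2); first by rewrite divr_gt0.
    move=> x y x01; apply: dP; last by rewrite /= in_itv.
    - by rewrite /= sub0r normrN gtr0_norm ?divr_gt0// gtr_pMr// invf_lt1// ltr1n.
    - by rewrite divr_gt0.
  have /cvgrPdist_lt/(_ _ e2)[r /= r0 rF] := cF x.
  have r2 : 0 < r / 2 by rewrite divr_gt0.
  near=> x' d => y xyd /=.
  have xx' : `|x - x'| < r / 2 by near: x'; exact: nbhsx_ballx.
  have dr : d < r / 2 by near: d; exact: nbhs_right_lt.
  have h1 : `|F x - F x'| < e / 2.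
    by apply: rF => /=; rewrite (lt_trans xx')// gtr_pMr// invf_lt1// ltr1n.
  have h2 : `|F x - F y| < e / 2.
    apply: rF => /=; rewrite (splitr r) (le_lt_trans (ler_distD x' _ _))//.
    by rewrite ltrD// (lt_trans xyd).
  move: h1 h2; rewrite !ltr_norml; lra.
have /continuous_subspaceT cFw := cF.
have [M /= M01 FM] := EVT_max (@ler01 R) (cFw `[0, 1]%classic).
have [m /= m01 Fm] := EVT_min (@ler01 R) (cFw `[0, 1]%classic).
have mM : F m <= F M by exact: FM.
exists ((F M - F m) / d ^+ 2).
  by rewrite divr_ge0 ?subr_ge0// exprn_ge0// ltW.
move=> x y x01 y01; have [xy|xy] := ltP `|x - y| d.
  apply: ltW (lt_le_trans (dF _ _ x01 xy) _); rewrite lerDl.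
  by rewrite mulr_ge0 ?sqr_ge0// divr_ge0 ?subr_ge0// exprn_ge0// ltW.
have FxM : F x <= F M by apply: FM; rewrite in_itv.
have Fmy : F m <= F y by apply: Fm; rewrite in_itv.
suff : F M - F m <= (F M - F m) / d ^+ 2 * (x - y) ^+ 2 by lra.
rewrite -mulrA ler_peMr ?subr_ge0// mulrC ler_pdivlMr ?exprn_gt0// mul1r.
by rewrite -(real_normK (num_real (x - y))) lerXn2r ?nnegrE// ltW.
Unshelve. all: by end_near. Qed.

(** Bernstein's proof: [uniform_modulus] compares [F] at the node [k / N] with
    [F s] up to [C (k / N - s)^2], and the mean of this quadratic term is at most
    [C / N] by [bernstein_sqr]. *)
Lemma weierstrass (F : R -> R) (e : R) : continuous F -> 0 < e ->
  exists q : {poly R}, forall s, 0 <= s <= 1 -> `|F s - q.[s]| <= e.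
Proof.
move=> cF e0; have e2 : 0 < e / 2 by rewrite divr_gt0.
have [C C0 CF] := uniform_modulus cF e2.
have [N NC] : exists N, 2 * C / e <= N.+1%:R.
  have /archi_boundP : 0 <= 2 * C / e by rewrite divr_ge0 ?mulr_ge0// ltW.
  set N := Num.bound _ => CN; exists N.
  by rewrite (le_trans (ltW CN))// ler_nat.
have N0 : 0 < N.+1%:R :> R by rewrite ltr0n.
have [q qE] := bernstein_poly N.+1 (fun k => F (k%:R / N.+1%:R)).
exists q => s s01; rewrite -qE.
have node k : (k <= N.+1)%N -> 0 <= k%:R / (N.+1%:R : R) <= 1.
  by move=> kN; rewrite divr_ge0//= ler_pdivrMr// mul1r ler_nat.
pose c := C / N.+1%:R ^+ 2.
pose sq k : R := (k%:R - N.+1%:R * s) ^+ 2.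
have sqE (k : nat) : C * (k%:R / N.+1%:R - s) ^+ 2 = c * sq k.
  by rewrite /c /sq; field; rewrite gt_eqF.
have sq_le : c * bernstein N.+1 sq s <= e / 2.
  rewrite bernstein_sqr subrr expr0n add0r.
  have -> : c * (N.+1%:R * (s * (1 - s))) = C * (s * (1 - s)) / N.+1%:R.
    by rewrite /c; field; rewrite gt_eqF.
  rewrite ler_pdivrMr//; move: NC; rewrite ler_pdivrMr// => NC.
  have : C * (s * (1 - s)) <= C * 1 by rewrite ler_wpM2l//; nra.
  by rewrite mulr1; lra.
have upper : bernstein N.+1 (fun k => F (k%:R / N.+1%:R)) s <= F s + e.
  have : bernstein N.+1 (fun k => F (k%:R / N.+1%:R)) s <=
         bernstein N.+1 (fun k => c * sq k + (F s + e / 2)) s.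
    apply: ler_bernstein => // k kN; rewrite -sqE.
    by have := CF _ _ (node k kN) s01; move: (C * _) => X; lra.
  by rewrite bernstein_affine; lra.
have lower : F s - e <= bernstein N.+1 (fun k => F (k%:R / N.+1%:R)) s.
  have : bernstein N.+1 (fun k => - c * sq k + (F s - e / 2)) s <=
         bernstein N.+1 (fun k => F (k%:R / N.+1%:R)) s.
    apply: ler_bernstein => // k kN; rewrite mulNr -sqE.
    have := CF _ _ s01 (node k kN); rewrite -(sqrrN (s - _)) opprB.
    by move: (C * _) => X; lra.
  by rewrite bernstein_affine; lra.
by rewrite ler_norml; apply/andP; split; lra.
Qed.

End Bernstein.

(** * Completeness of the Laguerre functions *)

Section DominatedConvergence.
Context d (T : measurableType d) (R : realType).
Variable mu : {measure set T -> \bar R}.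

Lemma Rintegral_dominated_cvg (D : set T) (f_ : nat -> T -> R) (f g : T -> R) :
  measurable D -> (forall n, measurable_fun D (f_ n)) -> measurable_fun D f ->
  (forall t, D t -> f_ ^~ t @ \oo --> f t) -> mu.-integrable D (EFin \o g) ->
  (forall n t, D t -> `|f_ n t| <= g t) ->
  (fun n => \int[mu]_(t in D) f_ n t) @ \oo --> \int[mu]_(t in D) f t.
Proof.
move=> mD mf_ mf f_f ig f_g.
have [||||| If _ Icvg] := @dominated_convergence _ _ _ mu D mD
  (fun n => EFin \o f_ n) (EFin \o f) (EFin \o g).
- by move=> n; exact/measurable_EFinP.
- exact/measurable_EFinP.
- by apply: aeW => t Dt; apply: cvg_EFin; [exact: nearW|exact: f_f].
- exact: ig.
- by apply: aeW => t n Dt; rewrite /= lee_fin f_g.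
- have /fineK IfE := integrable_fin_num mD If.
  by apply: fine_cvg; rewrite IfE.
Qed.

End DominatedConvergence.

Section Clip.
Context {R : realType}.
Implicit Types B x y : R.

Definition clip B x := Num.max (- B) (Num.min B x).

Lemma norm_clip B x : 0 <= B -> `|clip B x| <= B.
Proof.
move=> B0; rewrite /clip ler_norml.
case: (leP B x) => ?; [case: (leP (- B) B)|case: (leP (- B) x)] => ?;
  by apply/andP; split; lra.
Qed.

Lemma norm_clip_le B x : 0 <= B -> `|clip B x| <= `|x|.
Proof.
move=> B0; rewrite /clip.
case: (leP B x) => ?; [case: (leP (- B) B)|case: (leP (- B) x)] => ?.
- by rewrite !ger0_norm; lra.
- by exfalso; lra.
- by [].
- by rewrite normrN ger0_norm// ler0_norm; lra.
Qed.

Lemma dist_clip B x y : 0 <= B -> `|y| <= B -> `|y - clip B x| <= `|y - x|.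
Proof.
move=> B0; rewrite ler_norml => /andP[yB1 yB2].
rewrite /clip; case: (leP B x) => ?; [case: (leP (- B) B)|case: (leP (- B) x)] => ? //.
- by rewrite !ler0_norm; lra.
- by exfalso; lra.
- by rewrite !ger0_norm; lra.
Qed.

Lemma norm_subr_clip B x : 0 <= B -> `|x - clip B x| <= `|x|.
Proof.
move=> B0; rewrite /clip.
case: (leP B x) => ?; [case: (leP (- B) B)|case: (leP (- B) x)] => ?.
- by rewrite !ger0_norm; lra.
- by exfalso; lra.
- by rewrite subrr normr0.
- by rewrite !ler0_norm; lra.
Qed.

Lemma clip_id B x : `|x| <= B -> clip B x = x.
Proof. by rewrite ler_norml /clip => /andP[? ?]; rewrite min_r// max_r. Qed.

Lemma continuous_clip B : continuous (clip B).
Proof.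
move=> x; apply: (@continuous_max _ _ (cst (- B)) (Num.min B)); first exact: cvg_cst.
by apply: (@continuous_min _ _ (cst B) id); [exact: cvg_cst|exact: cvg_id].
Qed.

End Clip.

Section Density.
Context {R : realType}.
Local Notation mu := (@lebesgue_measure R).
Local Notation "'R+'" := (`[0, +oo[%classic : set R).
Local Notation expandable := (expandable mu laguerre_fun).
Implicit Types (t : R) (f g v w : R -> R).

Lemma measurable_sub_sqr f g : measurable_fun setT f -> measurable_fun setT g ->
  measurable_fun setT (fun t => (f t - g t) ^+ 2).
Proof. by move=> mf mg; apply: measurable_funX; exact: measurable_funB. Qed.

Lemma L2_dominated f g : measurable_fun setT f -> g \in Lfun mu 2%:E ->
  (forall t, `|f t| <= `|g t|) ->
  f \in Lfun mu 2%:E /\ ip mu f f <= ip mu g g.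
Proof.
move=> mf gL fg.
have fg2 t : f t ^+ 2 <= g t ^+ 2.
  rewrite -(real_normK (num_real (f t))) -(real_normK (num_real (g t))).
  by rewrite lerXn2r ?nnegrE.
have fL : f \in Lfun mu 2%:E.
  apply: Lfun2_sqr_integrable => //.
  apply: (le_integrable measurableT _ _ (Lfun2_integrable_sqr gL)).
    by apply/measurable_EFinP; exact: measurable_funX.
  by move=> t _; rewrite /= lee_fin !ger0_norm ?sqr_ge0.
split=> //; rewrite !ipE; apply: le_Rintegral => //; try exact: ip_integrable.
by move=> t _; rewrite -!expr2.
Qed.

Lemma poly_expR_expandable (q : {poly R}) :
  expandable ((fun t => expR (- t) * q.[expR (- t)]) \_ R+).
Proof.
rewrite (_ : patch _ _ _ = \sum_(i < size q) q`_i *: exp_poly i.+1%:R 1).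
  apply: (expandable_sum laguerre_fun_L2 laguerre_fun_orthonormal) => i.
  apply: (expandableZ laguerre_fun_L2).
  by apply: exp_expandable; rewrite ltr0n.
apply/funext => t; rewrite fct_sumE patchE.
under eq_bigr do rewrite fctE /exp_poly patchE.
case: ifP => _; last by rewrite big1// => i _; rewrite scaler0.
rewrite horner_coef mulr_sumr; apply: eq_bigr => i _.
by rewrite hornerC mul1r -mulrN expRM_natl exprS /GRing.scale/=; ring.
Qed.

(** In the variable [s = exp (- t)] the function [exp t * w t] becomes continuous
    on [[0, 1]]; a polynomial [q] uniformly [e]-close to it makes
    [exp (- t) * q (exp (- t))] pointwise [e * exp (- t)]-close to [w], which is
    small in [L^2]. *)
Lemma continuous_expandable w : continuous w -> (forall t, 2 <= t -> w t = 0) ->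
  expandable (w \_ R+).
Proof.
move=> cw w2; pose c : R := expR (- 2); have c0 : 0 < c by exact: expR_gt0.
(* Clamping [s] from below at [exp (- 2)] avoids the singularity of the logarithm
   and does not change the values, as [w] vanishes beyond [2]. *)
pose F (s : R) : R := w (- ln (Num.max s c)) / Num.max s c.
have max0 s : 0 < Num.max s c by rewrite lt_max c0 orbT.
have cF : continuous F.
  move=> s; have cmax : {for s, continuous (fun s => Num.max s c)}.
    by apply: continuous_max; [exact: cvg_id|exact: cvg_cst].
  apply: cvgM; last by apply: cvgV => //; rewrite gt_eqF.
  apply: (@continuous_comp _ _ _ (fun s => - ln (Num.max s c)) w); last exact: cw.
  apply: cvgN; apply: (@continuous_comp _ _ _ (fun s => Num.max s c) (@ln R)) => //.
  exact: continuous_ln.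
have wF t : w t = expR (- t) * F (expR (- t)).
  rewrite /F; case: (leP (expR (- t)) c) => tc.
    rewrite /c expRK opprK !w2 ?mul0r ?mulr0//.
    by move: tc; rewrite ler_expR lerN2.
  by rewrite expRK opprK mulrCA mulfV ?mulr1// gt_eqF ?expR_gt0.
have mw : measurable_fun setT (w \_ R+).
  apply/measurable_restrict => //; apply: measurable_funTS.
  exact: continuous_measurable_fun.
pose pw q : R -> R := (fun t => expR (- t) * q.[expR (- t)]) \_ R+.
have approx e : 0 < e -> exists q : {poly R},
    forall t, `|(w \_ R+ - pw q) t| <= `|(e *: exp_poly 1 1) t|.
  move=> e0; have [q qF] := weierstrass cF e0; exists q => t.
  rewrite !fctE /pw /exp_poly !patchE; case: ifPn => [|_]; last first.
    by rewrite subr0 scaler0.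
  rewrite inE/= in_itv/= andbT => t0.
  rewrite hornerC !mul1r wF -mulrBr !normrM mulrC (gtr0_norm e0).
  by rewrite ler_pM2r ?normr_gt0 ?gt_eqF ?expR_gt0// qF// expR_ge0 expR_le1 oppr_le0.
have e1L : @exp_poly R 1 1 \in Lfun mu 2%:E by exact: exp_poly_L2.
have pwL q : pw q \in Lfun mu 2%:E by have [] := poly_expR_expandable q.
have mB q : measurable_fun setT (w \_ R+ - pw q).
  by apply: measurable_funB => //; exact: (Lfun2_measurable (pwL q)).
have wL : w \_ R+ \in Lfun mu 2%:E.
  have [q qw] := approx 1 ltr01.
  have [wqL _] := L2_dominated (mB q) (L2Z _ e1L) qw.
  by rewrite -(subrK (pw q) (w \_ R+)); exact: L2D.
apply: (expandable_closed laguerre_fun_L2 laguerre_fun_orthonormal wL) => e e0.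
have [q qw] := approx (Num.sqrt e) (etrans (sqrtr_gt0 e) e0).
exists (pw q); first exact: poly_expR_expandable.
have [_ /le_lt_trans] := L2_dominated (mB q) (L2Z _ e1L) qw; apply.
rewrite ipZl ?L2Z// ipC ipZl// ip_exp// mulr1 mulrA -expr2 sqr_sqrtr ?ltW//.
by lra.
Qed.

(** For bounded functions [L^1] approximation gives [L^2] approximation, since
    [(v - w)^2 <= 2 B |v - w|]. *)
Lemma bounded_expandable v B : 0 < B -> measurable_fun setT v ->
  (forall t, `|v t| <= B) -> (forall t, t \notin `[0, 1] -> v t = 0) ->
  expandable v.
Proof.
move=> B0 mv vB v01. pose E := `[0, 2]%classic : set R.
have B00 := ltW B0.
have mE : measurable (E : set (measurableTypeR R)) by exact: measurable_itv.
have Efin : (mu E < +oo)%E.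
  by rewrite /E lebesgue_measure_itv/= lte_fin ltr0n/= -EFinB ltry.
have vL : v \in Lfun mu 2%:E.
  have eL : @exp_poly R 1 1 \in Lfun mu 2%:E by exact: exp_poly_L2.
  have [] // := L2_dominated mv (L2Z (B * expR 1) eL).
  move=> t; have [t01|/v01->] := boolP (t \in `[0, 1]); last by rewrite normr0.
  move: t01; rewrite in_itv/= => /andP[t0 t1].
  rewrite fctE /exp_poly patchE ifT; last by rewrite inE/= in_itv/= t0.
  rewrite hornerC !mul1r /GRing.scale/= -mulrA -expRD (le_trans (vB t))//.
  rewrite ger0_norm ?mulr_ge0 ?expR_ge0// ler_peMr//.
  by rewrite -[leLHS]expR0 ler_expR subr_ge0.
have vI : mu.-integrable E (EFin \o v).
  apply: measurable_bounded_integrable => //; first exact: measurable_funTS.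
  exists B; split; rewrite ?num_real// => x Bx t _.
  exact: le_trans (vB t) (ltW Bx).
apply: (expandable_closed laguerre_fun_L2 laguerre_fun_orthonormal vL) => e e0.
have [g_ [cg ig gcv]] := approximation_continuous_integrable mE Efin vI.
have eB : 0 < e / (2 * B) by rewrite divr_gt0// mulr_gt0.
have [n gn] : exists n, \int[mu]_(t in E) `|v t - g_ n t| < e / (2 * B).
  have /fine_cvgP[_ /nneg_cvg0P gcv'] := gcv.
  have /filter_ex[n gn] : \forall n \near \oo,
      \int[mu]_(t in E) `|v t - g_ n t| < e / (2 * B).
    by apply: gcv' eB => n; apply: fine_ge0; exact: integral_ge0.
  by exists n.
(* The [L^1] approximation takes place on [[0, 2]], where [v] vanishes on the second
   half: a cutoff equal to [1] on [[0, 1]] and to [0] beyond [2] can only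
   decrease the error, and so does clipping at [B]. *)
pose w t := Num.max 0 (Num.min 1 (2 - t)) * clip B (g_ n t).
have cw : continuous w.
  move=> t; apply: cvgM.
    apply: (@continuous_max _ _ (cst 0) (fun t => Num.min 1 (2 - t))).
      exact: cvg_cst.
    apply: (@continuous_min _ _ (cst 1) (fun t => 2 - t)); first exact: cvg_cst.
    by apply: cvgB; [exact: cvg_cst|exact: cvg_id].
  by apply: (@continuous_comp _ _ _ (g_ n)); [exact: cg|exact: continuous_clip].
have w2 t : 2 <= t -> w t = 0.
  by move=> t2; rewrite /w max_l ?mul0r// ge_min subr_le0 t2 orbT.
exists (w \_ R+); first exact: continuous_expandable.
have wB t : `|w t| <= `|clip B (g_ n t)|.
  rewrite normrM ler_piMl// ger0_norm ?le_max ?lexx//.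
  by rewrite ge_max ler01 ge_min lexx.
have sqr_le t : (v t - (w \_ R+) t) ^+ 2 <=
    ((fun t => 2 * B * `|v t - g_ n t|) \_ E) t.
  have pt0 : point = 0 :> R by [].
  rewrite !patchE /E !mem_setE !in_itv/= andbT pt0.
  have [/andP[t0 t2]|] := boolP (0 <= t <= 2); last first.
    rewrite negb_and -!ltNge => /orP[t0|t2].
      by rewrite [0 <= t]leNgt t0/= v01 ?subrr ?expr0n// in_itv/= [0 <= t]leNgt t0.
    rewrite w2 ?(ltW t2)// if_same v01 ?subrr ?expr0n//.
    by rewrite in_itv/= [t <= 1]leNgt (lt_trans _ t2) ?ltr1n// andbF.
  rewrite t0.
  rewrite -(real_normK (num_real (v t - w t))) expr2 ler_pM//.
    rewrite (le_trans (ler_normB _ _))// mulrDl mul1r lerD//.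
    by rewrite (le_trans (wB t))// norm_clip.
  have [t1|t1] := leP t 1.
    rewrite /w min_l; last by lra.
    by rewrite max_r// mul1r dist_clip.
  rewrite v01; last by rewrite in_itv/= [t <= 1]leNgt t1 andbF.
  by rewrite !sub0r !normrN (le_trans (wB t))// norm_clip_le.
have dI : mu.-integrable E (EFin \o (fun t => `|v t - g_ n t|)).
  have dI0 := integrableB mE vI (ig n).
  have := integrable_abse dI0.
  by apply: eq_integrable.
have wL : w \_ R+ \in Lfun mu 2%:E by have [] := continuous_expandable cw w2.
apply: (@le_lt_trans _ _ (2 * B * \int[mu]_(t in E) `|v t - g_ n t|)); last first.
  by rewrite mulrC -ltr_pdivlMr// mulr_gt0.
rewrite -RintegralZl// [leRHS]Rintegral_mkcond ipE; apply: le_Rintegral => //.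
- by apply: ip_integrable; exact: L2B.
- have /integrable_mkcond := integrableZl mE (2 * B) dI.
  by move=> /(_ mE); apply: eq_integrable => // t _; rewrite restrict_EFin.
- by move=> t _; rewrite -expr2; exact: sqr_le.
Qed.

(** Truncating the values at [n + 1] converges in [L^2] by dominated
    convergence. *)
Lemma L2_expandable v : v \in Lfun mu 2%:E ->
  (forall t, t \notin `[0, 1] -> v t = 0) -> expandable v.
Proof.
move=> vL v01; have mv := Lfun2_measurable vL.
apply: (expandable_closed laguerre_fun_L2 laguerre_fun_orthonormal vL) => e e0.
pose c n t := clip n.+1%:R (v t).
have mc n : measurable_fun setT (c n).
  apply: measurableT_comp => //; apply: continuous_measurable_fun.
  exact: continuous_clip.
have cE n : expandable (c n).
  apply: (@bounded_expandable _ n.+1%:R) => //.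
    by move=> t; exact: norm_clip.
  by move=> t /v01 vt; rewrite /c vt clip_id ?normr0.
have msub n : measurable_fun setT (fun t => (v t - c n t) ^+ 2).
  exact: measurable_sub_sqr.
have clip_lim t : (fun n => (v t - c n t) ^+ 2) @ \oo --> (0 : R).
  apply: cvg_near_cst; exists (Num.bound `|v t|) => // n /= vn.
  rewrite /c clip_id ?subrr ?expr0n//.
  rewrite (le_trans (ltW (archi_boundP (normr_ge0 (v t)))))// ler_nat.
  exact: leqW.
have sub_le n t : `|(v t - c n t) ^+ 2| <= v t ^+ 2.
  rewrite ger0_norm ?sqr_ge0//.
  rewrite -(real_normK (num_real (v t))) -(real_normK (num_real (v t - _))).
  by rewrite lerXn2r ?nnegrE// norm_subr_clip.
have := @Rintegral_dominated_cvg _ _ R mu setT (fun n t => (v t - c n t) ^+ 2)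
  (cst 0) (fun t => v t ^+ 2) measurableT msub (measurable_cst _)
  (fun t _ => clip_lim t) (Lfun2_integrable_sqr vL) (fun n t _ => sub_le n t).
rewrite Rintegral_cst// mul0r => /nneg_cvg0P h.
have /filter_ex[n vn] : \forall n \near \oo, \int[mu]_t ((v t - c n t) ^+ 2) < e.
  by apply: h e0 => n; apply: Rintegral_ge0 => t _; exact: sqr_ge0.
exists (c n) => //; rewrite ipE; apply: le_lt_trans vn.
rewrite le_eqVlt; apply/orP; left; apply/eqP.
by apply: eq_Rintegral => t _; rewrite -expr2.
Qed.

End Density.

(** * Delannoy numbers and the values of the Pollaczek polynomials *)

Section Delannoy.
Context (R : comNzRingType).

Definition delannoy n k : R := \sum_(j < n.+1) 'C(n, j)%:R * 2 ^+ j * 'C(k, j)%:R.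

Lemma delannoyC n k : delannoy n k = delannoy k n.
Proof.
have wide a b : delannoy a b = \sum_(j < (a + b).+1) 'C(a, j)%:R * 2 ^+ j * 'C(b, j)%:R.
  rewrite (big_ord_wide (N := a.+1) (F := fun j => 'C(a, j)%:R * 2 ^+ j * 'C(b, j)%:R))//.
    by rewrite ltnS leq_addr.
  by move=> j aj; rewrite bin_small// !mul0r.
rewrite !wide addnC; apply: eq_bigr => j _; ring.
Qed.

(** By symmetry the sum may be taken over [j <= k], a range independent of [n].
    After expanding [k * C(k, j)] on the products [C(k, j)], [C(k, j + 1)] and
    shifting the index, the recurrence holds term by term ([key]). *)
Lemma delannoy_rec n k :
  n.+1%:R * delannoy n.+1 k =
  (k.*2.+1)%:R * delannoy n k + n%:R * delannoy n.-1 k.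
Proof.
rewrite !(delannoyC _ k) /delannoy.
have dbl m : (m.*2.+1)%:R = 2 * m%:R + 1 :> R.
  by rewrite -mul2n -natr1 natrM.
have kbin j : k%:R * 'C(k, j)%:R = j%:R * 'C(k, j)%:R + j.+1%:R * 'C(k, j.+1)%:R :> R.
  rewrite -!natrM mul_bin_left -natrD -mulnDl.
  case: (leqP j k) => [jk|kj]; first by rewrite subnKC.
  by rewrite bin_small// !muln0.
have shift : \sum_(j < k.+1) j.+1%:R * 'C(k, j.+1)%:R * 2 ^+ j.+1 * 'C(n, j)%:R =
    \sum_(j < k.+1) j%:R * 'C(k, j)%:R * 2 ^+ j * 'C(n, j.-1)%:R :> R.
  rewrite big_ord_recr/= bin_small// mulr0 !mul0r addr0.
  by rewrite [RHS]big_ord_recl !mul0r add0r.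
have -> : (k.*2.+1)%:R * (\sum_(j < k.+1) 'C(k, j)%:R * 2 ^+ j * 'C(n, j)%:R) =
    \sum_(j < k.+1) ((j.*2.+1)%:R * 'C(k, j)%:R * 2 ^+ j * 'C(n, j)%:R) +
    \sum_(j < k.+1) j%:R * 'C(k, j)%:R * 2 ^+ j * 'C(n, j.-1)%:R :> R.
  rewrite -shift -big_split mulr_sumr dbl; apply: eq_bigr => j _ /=.
  transitivity ((2 * (k%:R * 'C(k, j)%:R) + 'C(k, j)%:R) * 2 ^+ j * 'C(n, j)%:R : R).
    by ring.
  by rewrite kbin exprS dbl; ring.
rewrite !mulr_sumr -!big_split; apply: eq_bigr => j _ /=.
have key : n.+1%:R * 'C(n.+1, j)%:R = (2 * j%:R + 1) * 'C(n, j)%:R +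
    j%:R * 'C(n, j.-1)%:R + n%:R * 'C(n.-1, j)%:R :> R.
  case: n {shift} => [|n].
    case: j => -[|[|j]] jk //=; rewrite ?bin0 ?bin1 ?bin_small//; ring.
  case: j => -[|j] jk /=.
    by rewrite !bin0 -!natr1; ring.
  have e1 : j.+1%:R * ('C(n.+1, j.+1)%:R + 'C(n.+1, j)%:R) =
      n.+2%:R * 'C(n.+1, j)%:R :> R.
    by rewrite -natrD -binS -!natrM mul_bin_diag.
  have e2 : n.+1%:R * 'C(n, j.+1)%:R + j.+1%:R * 'C(n.+1, j.+1)%:R =
      n.+1%:R * 'C(n.+1, j.+1)%:R :> R.
    by rewrite -!natrM -natrD -[(j.+1 * _)%N]mul_bin_diag -mulnDr -binS.
  rewrite binS natrD mulrDr -e1.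
  transitivity (n.+1%:R * 'C(n.+1, j.+1)%:R + 'C(n.+1, j.+1)%:R +
    j.+1%:R * ('C(n.+1, j.+1)%:R + 'C(n.+1, j)%:R) : R).
    by rewrite -[n.+2%:R]natr1; ring.
  by rewrite -e2; ring.
transitivity (n.+1%:R * 'C(n.+1, j)%:R * ('C(k, j)%:R * 2 ^+ j) : R); first by ring.
by rewrite key dbl; ring.
Qed.

End Delannoy.

Section PollaczekValues.
Context {R : realType}.

Lemma pollaczek_delannoy n k :
  (@pollaczek R n).[- 'i%C * (k%:R + 2^-1)] = (- 'i%C) ^+ n * delannoy _ n k.
Proof.
set y := - 'i%C * _.
have y2 : 2 * y = (- 'i%C) * (k.*2.+1)%:R.
  by rewrite /y -[(k.*2.+1)%:R]natr1 -mul2n natrM; field.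
have i2 : (- 'i%C) * (- 'i%C) = -1 :> R[i] by rewrite mulrNN -expr2 sqr_i.
suff H m : (pollaczek m).[y] = (- 'i%C) ^+ m * delannoy _ m k /\
    (pollaczek m.+1).[y] = (- 'i%C) ^+ m.+1 * delannoy _ m.+1 k by case: (H n).
elim: m => [|m [IH1 IH2]].
  have P0 : (pollaczek 0).[y] = (- 'i%C) ^+ 0 * delannoy _ 0 k.
    by rewrite pollaczek0 hornerC /delannoy big_ord1 !bin0 !mul1r.
  split=> //; have /eqP := pollaczekS 0 y.
  rewrite mul1r mul0r addr0 subr_eq0 => /eqP ->.
  have := delannoy_rec R[i] 0 k; rewrite mul1r mul0r addr0 => ->.
  by rewrite P0 y2 expr0 expr1; ring.
split=> //; apply: (@mulfI _ m.+2%:R); first by rewrite pnatr_eq0.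
have /eqP := pollaczekS m.+1 y; rewrite IH1 IH2 y2 /= addr_eq0 subr_eq => /eqP ->.
rewrite [RHS]mulrCA delannoy_rec /=.
rewrite mulrDr.
have -> : (- 'i%C) ^+ m.+2 = - (- 'i%C) ^+ m :> R[i].
  by rewrite !exprS mulrA i2 mulN1r.
rewrite exprS; set I := (- 'i%C) ^+ m.
transitivity (- (m.+1%:R * (I * delannoy _ m k)) +
  (- 'i%C) * (- 'i%C) * I * ((k.*2.+1)%:R * delannoy R[i] m.+1 k)).
  by ring.
by rewrite i2; ring.
Qed.

End PollaczekValues.

(** * Summation of the coefficient series *)

Section MomentSeries.
Context {R : realType}.
Local Notation mu := (@lebesgue_measure R).
Local Notation "'I01'" := (`[0, 1]%classic : set R).
Variables (m : nat -> R) (u : R -> R).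
Hypothesis Iu : mu.-integrable I01 (EFin \o u).
Hypothesis mE : forall n, m n = \int[mu]_(t in I01) (t ^+ n * u t).

Let mI : measurable (I01 : set (measurableTypeR R)).
Proof. exact: measurable_itv. Qed.

Let mu_ : measurable_fun (I01 : set (measurableTypeR R)) u.
Proof. by case/integrableP : Iu => /measurable_EFinP. Qed.

Lemma integrable_bounded_mul (g : R -> R) B : continuous g ->
  (forall t, 0 <= t <= 1 -> `|g t| <= B) ->
  mu.-integrable I01 (EFin \o (fun t => g t * u t)).
Proof.
move=> cg gB; apply: (le_integrable mI _ _ (integrableZl mI B Iu)).
  apply/measurable_EFinP; apply: measurable_funM => //.
  by apply: measurable_funTS; exact: continuous_measurable_fun.
move=> t; rewrite /= in_itv/= => t01; rewrite lee_fin !normrM ler_wpM2r//.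
by rewrite (le_trans (gB t t01))// ler_norm.
Qed.

Lemma integrable_exprn_mul n : mu.-integrable I01 (EFin \o (fun t => t ^+ n * u t)).
Proof.
apply: (@integrable_bounded_mul (fun t => t ^+ n) 1); first exact: exprn_continuous.
by move=> t /andP[t0 t1]; rewrite ger0_norm ?exprn_ge0// exprn_ile1.
Qed.

Lemma series_exp_coeffN_le (t : R) n : 0 <= t <= 1 ->
  `|series (exp_coeff (- t)) n| <= expR 1.
Proof.
move=> /andP[t0 t1].
apply: le_trans (_ : series (exp_coeff t) n <= _).
  rewrite /series/= (le_trans (ler_norm_sum _ _ _))// ler_sum// => i _.
  by rewrite /exp_coeff/= normrM normrX normrN (ger0_norm t0) ger0_norm// invr_ge0.
apply: le_trans (_ : expR t <= _); last by rewrite ler_expR.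
apply: nondecreasing_cvgn_le; last exact: is_cvg_series_exp_coeff.
apply/nondecreasing_seqP => k; rewrite /series/= big_nat_recr//= lerDl.
exact: exp_coeff_ge0.
Qed.

(** The partial sums are the integrals of the Taylor polynomials of [exp (- t)]
    against [t^j u], and these polynomials are bounded by [exp 1] on [[0, 1]]. *)
Lemma exp_moment_cvg j :
  (fun K => \sum_(i < K) (-1) ^+ i / i`!%:R * m (i + j)%N) @ \oo -->
  \int[mu]_(t in I01) (expR (- t) * (t ^+ j * u t)).
Proof.
have Ij := integrable_exprn_mul j.
have mj : measurable_fun (I01 : set (measurableTypeR R)) (fun t => t ^+ j * u t).
  by case/integrableP : Ij => /measurable_EFinP.
have cs K : continuous (fun t : R => series (exp_coeff (- t)) K).
  apply: continuous_big => [|i _ t]; first exact: add_continuous.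
  apply: cvgMr_tmp; apply: (@continuous_comp _ _ _ (-%R) (fun x : R => x ^+ i)).
    exact: opp_continuous.
  exact: exprn_continuous.
rewrite (_ : (fun K => _) = fun K =>
    \int[mu]_(t in I01) (series (exp_coeff (- t)) K * (t ^+ j * u t))).
  apply: (@Rintegral_dominated_cvg _ _ R mu I01
    (fun K t => series (exp_coeff (- t)) K * (t ^+ j * u t)) _
    (fun t => expR 1 * `|t ^+ j * u t|)) => //.
  - move=> K; apply: measurable_funM => //; apply: measurable_funTS.
    exact: continuous_measurable_fun.
  - apply: measurable_funM => //; apply: measurable_funTS.
    apply: continuous_measurable_fun => t.
    by apply: (@continuous_comp _ _ _ (-%R) expR);
      [exact: opp_continuous|exact: continuous_expR].
  - by move=> t _; apply: cvgMr_tmp; exact: is_cvg_series_exp_coeff.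
  - exact: (integrableZl mI (expR 1) (integrable_abse Ij)).
  - move=> K t; rewrite /= in_itv/= => t01.
    by rewrite normrM ler_wpM2r// series_exp_coeffN_le.
apply/funext => K.
transitivity (\int[mu]_(t in I01)
    \sum_(i < K) ((-1) ^+ i / i`!%:R * (t ^+ (i + j) * u t))).
  rewrite Rintegral_sum//; last first.
    by move=> i; exact: (integrableZl mI _ (integrable_exprn_mul _)).
  by apply: eq_bigr => i _; rewrite RintegralZl// ?mE//; exact: integrable_exprn_mul.
apply: eq_Rintegral => t _; rewrite /series/= big_mkord mulr_suml.
by apply: eq_bigr => i _; rewrite /exp_coeff/= (exprNn t) exprD; ring.
Qed.

Lemma cvg_sum_ord n (F : 'I_n -> nat -> R) (l : 'I_n -> R) :
  (forall j, F j @ \oo --> l j) ->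
  (fun K => \sum_(j < n) F j K) @ \oo --> \sum_(j < n) l j.
Proof. by move=> Fl; apply: cvg_big => [|j _]; [exact: add_continuous|exact: Fl]. Qed.

(** Expanding [D(n, k)] over [j] splits the series into finitely many ones; in the
    [j]-th one [C(k, j) / k! = 1 / (j! (k - j)!)], so that after dropping its first
    [j] terms, which vanish, [exp_moment_cvg] applies, and the sum over [j]
    rebuilds [L_n(2 t)]. *)
Lemma delannoy_moment_cvg n :
  (fun K => \sum_(k < K) (-1) ^+ k / k`!%:R * m k * delannoy R n k) @ \oo -->
  \int[mu]_(t in I01) ((laguerre n).[2 * t] * expR (- t) * u t).
Proof.
rewrite (_ : (fun K => _) = fun K => \sum_(j < n.+1) ('C(n, j)%:R * 2 ^+ j *
    \sum_(k < K) (-1) ^+ k / k`!%:R * m k * 'C(k, j)%:R)); last first.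
  apply/funext => K; under [RHS]eq_bigr do rewrite mulr_sumr.
  rewrite exchange_big/=; apply: eq_bigr => k _.
  by rewrite /delannoy mulr_sumr; apply: eq_bigr => j _; ring.
have term_cvg j : (fun K => \sum_(k < K) (-1) ^+ k / k`!%:R * m k * 'C(k, j)%:R)
    @ \oo --> (-1) ^+ j / j`!%:R * \int[mu]_(t in I01) (expR (- t) * (t ^+ j * u t)).
  set a := fun K => _; set l := _ * _.
  have <- := cvg_shiftn j a (nbhs (l : R)).
  rewrite (_ : [sequence _]_K = fun K => (-1) ^+ j / j`!%:R *
      \sum_(i < K) (-1) ^+ i / i`!%:R * m (i + j)%N).
    exact: cvgMl_tmp (@exp_moment_cvg j).
  apply/funext => K; rewrite /a/= addnC big_split_ord/= big1 ?add0r; last first.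
    by move=> i _; rewrite bin_small// mulr0.
  rewrite mulr_sumr; apply: eq_bigr => i _; rewrite (addnC j).
  have /(congr1 (fun k => k%:R : R)) := bin_fact (leq_addl i j).
  rewrite addnK !natrM => h.
  have f0 k : k`!%:R != 0 :> R by rewrite pnatr_eq0 -lt0n fact_gt0.
  have -> : 'C(i + j, j)%:R = (i + j)`!%:R / (j`!%:R * i`!%:R) :> R.
    by rewrite -h; field; rewrite !f0.
  by rewrite exprD; field; rewrite !f0.
rewrite (_ : Rintegral _ _ _ = \sum_(j < n.+1) ('C(n, j)%:R * 2 ^+ j *
  ((-1) ^+ j / j`!%:R * \int[mu]_(t in I01) (expR (- t) * (t ^+ j * u t))))).
  by apply: cvg_sum_ord => j; exact: cvgMl_tmp (term_cvg j).
have Ij j : mu.-integrable I01 (EFin \o (fun t => expR (- t) * (t ^+ j * u t))).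
  have : mu.-integrable I01 (EFin \o (fun t => (t ^+ j * expR (- t)) * u t)).
    apply: (@integrable_bounded_mul (fun t => t ^+ j * expR (- t)) 1).
      have := @continuous_horner_expR R 1 1 'X^j.
      by under eq_fun do rewrite hornerXn !mul1r.
    move=> t /andP[t0 t1]; rewrite ger0_norm ?mulr_ge0 ?exprn_ge0 ?expR_ge0//.
    by rewrite mulr_ile1 ?exprn_ge0 ?expR_ge0 ?exprn_ile1// expR_le1 oppr_le0.
  by apply: eq_integrable => // t _; rewrite /= mulrCA mulrA.
transitivity (\int[mu]_(t in I01) \sum_(j < n.+1)
    ('C(n, j)%:R * 2 ^+ j * ((-1) ^+ j / j`!%:R)) * (expR (- t) * (t ^+ j * u t))).
  apply: eq_Rintegral => t _.
  rewrite laguerreE horner_sum !mulr_suml; apply: eq_bigr => j _.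
  by rewrite hornerZ hornerXn exprMn; ring.
rewrite Rintegral_sum//; last by move=> j; exact: (integrableZl mI _ (Ij j)).
by apply: eq_bigr => j _; rewrite (RintegralZl _ mI (Ij j)) !mulrA.
Qed.

End MomentSeries.

(** * Identification of the complex expansion *)

Section ComplexSeries.
Context {R : realType}.
Local Notation mu := (@lebesgue_measure R).
Local Notation "'R+'" := (`[0, +oo[%classic : set R).
Local Notation "'I01'" := (`[0, 1]%classic : set R).

Lemma cvg_real_complex (a : nat -> R) (l : R) : a @ \oo --> l ->
  (fun n => (a n)%:C : R[i]^o) @ \oo --> (l%:C : R[i]^o).
Proof.
move=> /cvgrPdist_lt al; apply/cvgrPdist_lt => e.
rewrite ltcE/= => /andP[/eqP e_im e0].
apply: filterS (al _ e0) => n aln.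
by rewrite -rmorphB /= normc_def/= expr0n addr0 sqrtr_sqr ltcE/= e_im eqxx.
Qed.

Lemma integrable_le1D (f g : R -> R) : measurable_fun setT f ->
  mu.-integrable I01 (EFin \o g) -> (forall t, 0 <= g t) ->
  (forall t, `|f t| <= 1 + g t) -> mu.-integrable I01 (EFin \o f).
Proof.
move=> mf Ig g0 fg.
have mI : measurable (I01 : set (measurableTypeR R)) by exact: measurable_itv.
have I1 : mu.-integrable I01 (EFin \o (fun=> 1 : R)).
  have Ifin : (mu I01 < +oo)%E.
    by rewrite lebesgue_measure_itv/= lte_fin ltr01 -EFinB ltry.
  apply: (measurable_bounded_integrable mI Ifin) => //.
  by exists 1; split; rewrite ?num_real// => x x1 t _ /=; rewrite normr1 ltW.
apply: (le_integrable mI _ _ (integrableD mI I1 Ig)).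
  by apply/measurable_EFinP; exact: measurable_funTS.
by move=> t _; rewrite /= lee_fin (le_trans (fg t))// ler_norm.
Qed.

(** On [[0, 1]] the square of [v] is at most [1 + |v|^p]. *)
Lemma L2_of_Lp p (v : R -> R) : 2 <= p -> v \in Lfun mu p%:E ->
  (forall t, t \notin `[0, 1] -> v t = 0) -> v \in Lfun mu 2%:E.
Proof.
move=> p2 vLp v01.
have mv : measurable_fun setT v by move: vLp; rewrite inE => /andP[/[!inE]].
have p1 : 1 <= p by rewrite (le_trans _ p2)// ler1n.
have mI : measurable (I01 : set (measurableTypeR R)) by exact: measurable_itv.
have Ip := integrableS measurableT mI (@subsetT _ _) (Lfun_integrable p1 vLp).
have I2 : mu.-integrable I01 (EFin \o (fun t => v t ^+ 2)).
  apply: (integrable_le1D _ Ip) => [|t|t]; first exact: measurable_funX.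
    exact: powR_ge0.
  rewrite ger0_norm ?sqr_ge0// -(real_normK (num_real (v t))).
  have [v1|v1] := leP `|v t| 1.
    by rewrite (le_trans (exprn_ile1 _ (normr_ge0 _) v1))// lerDl powR_ge0.
  by rewrite -powR_mulrn// (le_trans (ler_powR (ltW v1) p2))// lerDr.
apply: Lfun2_sqr_integrable => //.
move/integrable_mkcond : I2 => /(_ mI); apply: eq_integrable => // t _.
rewrite patchE mem_setE; case: ifPn => //= t01.
by rewrite v01// expr0n.
Qed.

Lemma L2_integrable (v : R -> R) : v \in Lfun mu 2%:E ->
  mu.-integrable I01 (EFin \o v).
Proof.
move=> vL; have mI : measurable (I01 : set (measurableTypeR R)) by exact: measurable_itv.
have I2 := integrableS measurableT mI (@subsetT _ _) (Lfun2_integrable_sqr vL).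
apply: (integrable_le1D (Lfun2_measurable vL) I2) => t; first exact: sqr_ge0.
rewrite -(real_normK (num_real (v t))); have := sqr_ge0 (`|v t| - 1).
by have := normr_ge0 (v t); move: `|v t| => x; nra.
Qed.

Lemma ip_laguerre_fun (u : R -> R) n : u \_ I01 \in Lfun mu 2%:E ->
  ip mu (u \_ I01) (laguerre_fun n) =
  Num.sqrt 2 * \int[mu]_(t in I01) ((laguerre n).[2 * t] * expR (- t) * u t).
Proof.
move=> uL; have -> : laguerre_fun n = Num.sqrt 2 *: exp_poly 1 (laguerre n) :> (R -> R).
  apply/funext => t; rewrite fctE /laguerre_fun /exp_poly !patchE.
  by case: ifP => _; [rewrite hornerZ -mulrA|rewrite scaler0].
rewrite ipC ipZl ?exp_poly_L2//; congr (_ * _).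
rewrite ipE [RHS]Rintegral_mkcond; apply: eq_Rintegral => t _.
rewrite /exp_poly !patchE !mem_setE !in_itv/= andbT.
case: (leP 0 t) => t0 /=; last by rewrite mul0r.
by case: (leP t 1) => t1; [rewrite mul1r|rewrite mulr0].
Qed.

Lemma coef_series_cvg (m : nat -> R) (u : R -> R) n :
  mu.-integrable I01 (EFin \o u) ->
  (forall k, m k = \int[mu]_(t in I01) (t ^+ k * u t)) ->
  coef_series m n @ \oo --> ((- 'i%C) ^+ n *
   (\int[mu]_(t in I01) ((laguerre n).[2 * t] * expR (- t) * u t))%:C : R[i]^o).
Proof.
move=> Iu mE.
have -> : coef_series m n = (fun K => (- 'i%C) ^+ n *
    (\sum_(k < K) (-1) ^+ k / k`!%:R * m k * delannoy R n k)%:C : R[i]^o).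
  apply/funext => K; rewrite /coef_series /series/= big_mkord rmorph_sum mulr_sumr.
  apply: eq_bigr => k _; rewrite pollaczek_delannoy mulrCA; congr (_ * _).
  rewrite [RHS]rmorphM; congr (_ * _).
  rewrite /delannoy rmorph_sum/=; apply: eq_bigr => j _.
  by rewrite !rmorphM rmorphXn/= !rmorph_nat.
apply: (@cvgZl_tmp R[i] R[i]^o _ _ _ ((- 'i%C) ^+ n)).
by apply: cvg_real_complex; exact: delannoy_moment_cvg.
Qed.

Lemma coefE (m : nat -> R) (u : R -> R) n : u \_ I01 \in Lfun mu 2%:E ->
  mu.-integrable I01 (EFin \o u) ->
  (forall k, m k = \int[mu]_(t in I01) (t ^+ k * u t)) ->
  coef m n = (- 'i%C) ^+ n * (ip mu (u \_ I01) (laguerre_fun n))%:C.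
Proof.
move=> uL Iu mE; rewrite /coef (cvg_lim (@norm_hausdorff _ R[i]^o) (coef_series_cvg Iu mE)).
by rewrite ip_laguerre_fun// rmorphM mulrCA.
Qed.

(** The phases [(- i)^n] and [i^n] cancel: the complex expansion is the real
    Laguerre expansion. *)
Lemma coef_PhiE (m : nat -> R) (u : R -> R) n t : u \_ I01 \in Lfun mu 2%:E ->
  mu.-integrable I01 (EFin \o u) ->
  (forall k, m k = \int[mu]_(t in I01) (t ^+ k * u t)) -> 0 <= t ->
  coef m n * Phi n t =
  (ip mu (u \_ I01) (laguerre_fun n) * laguerre_fun n t)%:C.
Proof.
move=> uL Iu mE t0; rewrite (coefE n uL Iu mE) /Phi mulrACA -exprMn mulNr -expr2 sqr_i opprK.
rewrite expr1n mul1r -rmorphM; congr (_ * _)%:C.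
rewrite /laguerre_fun /exp_poly patchE ifT; last by rewrite mem_setE in_itv/= t0.
by rewrite hornerZ mul1r mulrAC.
Qed.

Lemma Lp_norm2E (f : R -> R[i]) (h : R -> R) : h \in Lfun mu 2%:E ->
  (fun t => ComplexField.Normc.normc (f t)) \_ R+ =1 (fun t => `|h t|) ->
  Lp_norm R+ 2 f = (Num.sqrt (ip mu h h))%:E.
Proof.
move=> hL fh.
have -> : Lp_norm R+ 2 f = Lnorm mu 2%:E (EFin \o (fun t => `|h t|)).
  by apply: eq_Lnorm => t; rewrite /= fh.
rewrite unlock (_ : (\int[mu]_t _)%E = (ip mu h h)%:E).
  by rewrite poweR_EFin powR12_sqrt// ip_ge0.
rewrite ipE /Rintegral fineK; last first.
  by apply: integrable_fin_num => //; exact: ip_integrable.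
apply: eq_integral => t _.
by rewrite /= normr_id powR_mulrn// real_normK ?num_real// expr2.
Qed.

End ComplexSeries.

Theorem theorem7 (R : realType) (mu : nat -> R) (eps p M : R) (u : R -> R)
  (eps_gt0 : 0 < eps) (p_ge : 2 + eps <= p) (M_gt0 : 0 < M)
  (mu_bound : forall n : nat,
    n.+1%:R `^ (p - 1) *
      \sum_(i < n.+1)
        `| 'C(n, i)%:R * (-1) ^+ (n - i) * fdiff (n - i) mu i | `^ p < M)
  (u_Lp : in_Lp `[0, 1] p u)
  (u_moments : forall n : nat,
    mu n = \int[@lebesgue_measure R]_(t in `[0, 1]) (t ^+ n * u t))
  (u_ext : forall t : R, 1 < t -> u t = 0) :
  (forall n : nat, cvgn (coef_series mu n)) /\
  Lp_series_cvg `[0, +oo[ 2 (fun n t => coef mu n * Phi n t) (fun t => (u t)%:C).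
Proof.
pose v : R -> R := u \_ `[0, 1].
have v01 t : t \notin `[0, 1] -> v t = 0.
  by move=> t01; rewrite /v patchE mem_setE (negbTE t01).
have vL : v \in Lfun (@lebesgue_measure R) 2%:E.
  by apply: (@L2_of_Lp _ p) => //; lra.
have Iu : (@lebesgue_measure R).-integrable `[0, 1] (EFin \o u).
  apply: eq_integrable (L2_integrable vL); first exact: measurable_itv.
  by move=> t t01; rewrite /= /v patchE t01.
have vR : u \_ `[0, +oo[ = v.
  apply/funext => t; rewrite /v !patchE !mem_setE !in_itv/= andbT.
  by case: (leP 0 t) => //= _; case: (leP t 1) => // /u_ext ->.
split=> [n|]; first by apply/cvg_ex; eexists; exact: (coef_series_cvg Iu u_moments).
have coefPhi n t := coef_PhiE n (t := t) vL Iu u_moments.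
pose e := @laguerre_fun R.
pose c n := ip (@lebesgue_measure R) v (e n).
have eL n : e n \in Lfun (@lebesgue_measure R) 2%:E by exact: laguerre_fun_L2.
have ePos n t : t \notin `[0, +oo[ -> e n t = 0.
  by move=> t0; rewrite /e /laguerre_fun /exp_poly patchE mem_setE (negbTE t0).
have term_re n : (fun t => complex.Re (coef mu n * Phi n t)) \_ `[0, +oo[ = c n *: e n.
  apply/funext => t; rewrite patchE mem_setE; case: ifPn => [|t0].
    by rewrite in_itv/= andbT => t0; rewrite coefPhi.
  by rewrite fctE ePos// scaler0.
have term_im n : (fun t => complex.Im (coef mu n * Phi n t)) \_ `[0, +oo[ = 0.
  apply/funext => t; rewrite patchE mem_setE; case: ifPn => [|//].
  by rewrite in_itv/= andbT => t0; rewrite coefPhi.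
split.
- by move=> n; split; rewrite /in_Lp ?term_re ?term_im; [exact: L2Z|exact: L20].
- split; rewrite /in_Lp; first by rewrite vR.
  rewrite (_ : patch _ _ _ = 0); first exact: L20.
  by apply/funext => t; rewrite patchE; case: ifP.
have [_ rcvg] := L2_expandable vL v01.
rewrite (_ : (fun N => _) = fun N => (Num.sqrt (ip (@lebesgue_measure R)
    (v - partial_exp (@lebesgue_measure R) e N v)
    (v - partial_exp (@lebesgue_measure R) e N v)))%:E).
  apply: cvg_EFin; first exact: nearW.
  rewrite -(@sqrtr0 R).
  exact: (cvg_comp _ _ rcvg (@sqrt_continuous R 0)).
apply/funext => N; apply: Lp_norm2E.
  by apply: L2B => //; exact: partial_exp_L2.
move=> t; rewrite patchE mem_setE; case: ifPn => [|t0].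
  rewrite in_itv/= andbT => t0.
  under eq_bigr do rewrite coefPhi//.
  rewrite -rmorph_sum -rmorphB /= expr0n addr0 sqrtr_sqr; congr `| _ |.
  rewrite /partial_exp !fctE fct_sumE; congr (_ - _).
  by rewrite -vR patchE ifT// mem_setE in_itv/= t0.
rewrite /partial_exp !fctE fct_sumE big1 ?subr0 => [|i _].
  by rewrite v01 ?normr0//; apply: contra t0; rewrite !in_itv/= andbT => /andP[].
by rewrite fctE -/(e i) ePos// scaler0.
Qed.
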